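(* Let $M=(E,\rho)$ be a $(q,r)$-polymatroid and let $U \leq E$. Then $$z^{\rho(E)} p(M^*.U;z) = \sum_{V \leq E} p(M.V;z) \sum_{j=0}^{\dim(U\cap V^\perp)} \left[\begin{matrix}\dim(U\cap V^\perp)\\ j\end{matrix}\right]_q(-1)^{\dim(U)-j} q^{\binom{\dim(U)-j}{2}}z^{jr}.$$
   Context: $q$ is a prime power, $n,r$ are positive integers, $E$ is an $n$-dimensional $\mathbb{F}_q$-vector space, and $\mathcal{L}(E)$ is the lattice of subspaces of $E$; $\leq$ denotes inclusion of subspaces. $\left[\begin{matrix} a\\ b\end{matrix}\right]_q=\prod_{i=0}^{b-1}\frac{q^a-q^i}{q^b-q^i}$ is the Gaussian coefficient (the number of $b$-dimensional subspaces of an $a$-dimensional $\mathbb{F}_q$-space). A $(q,r)$-polymatroid is a pair $M=(E,\rho)$ with $\rho:\mathcal{L}(E)\to\mathbb{N}_0$ such that for all $A,B\leq E$: (R1) $0\leq\rho(A)\leq r\dim A$; (R2) $A\leq B$ implies $\rho(A)\leq\rho(B)$; (R3) $\rho(A+B)+\rho(A\cap B)\leq\rho(A)+\rho(B)$. Fix an involutory lattice anti-isomorphism $U\mapsto U^\perp$ of $\mathcal{L}(E)$ (an order-reversing bijection interchanging sums and intersections, with $U^{\perp\perp}=U$; hence $\dim U^\perp=n-\dim U$). The dual of $M$ is the $(q,r)$-polymatroid $M^*=(E,\rho^* )$, $\rho^*(A)=r\dim(A)-\rho(E)+\rho(A^\perp)$. For $T\leq E$, the contraction $M/T$ is the $(q,r)$-polymatroid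 on $E/T$ with rank function $\rho_{M/T}(A/T)=\rho(A)-\rho(T)$ for $T\leq A\leq E$. For $X\leq E$, the contraction of $M$ to $X$ is $M.X:=M/X^\perp$ (likewise $M^*.X:=M^*/X^\perp$). For a $(q,r)$-polymatroid $N$ on a space $F$, put $\ell_N(A)=\rho_N(F)-\rho_N(A)$ for $A\leq F$; its characteristic polynomial is $p(N;z)=\sum_{X\leq F}\mu(0,X)z^{\ell_N(X)}\in\mathbb{Z}[z]$, where $\mu$ is the Möbius function of $\mathcal{L}(F)$, i.e. $\mu(U,V)=(-1)^{v-u}q^{\binom{v-u}{2}}$ for $U\leq V$ of dimensions $u,v$. *)

(* Defs.v *)
From HB Require Import structures.
From mathcomp Require Import all_boot all_order all_algebra all_field.
From mathcomp Require Import ring zify.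

Set Implicit Arguments.
Unset Strict Implicit.
Unset Printing Implicit Defensive.

Import GRing.Theory.
Local Open Scope ring_scope.

Section FiniteVspace.
Import VectorInternalTheory.

HB.instance Definition _ (F : finFieldType) (E : vectType F) :=
  [Countable of {vspace E} by <:].
HB.instance Definition _ (F : finFieldType) (E : vectType F) :=
  [Finite of {vspace E} by <:].

End FiniteVspace.

(* The quotient space E/T, i.e. the library's quotient of E by the additive   *)
(* subgroup T, with its vector space structure and the canonical projection.  *)
Section QuotientSpace.
Variables (K : fieldType) (E : vectType K) (T : {vspace E}).

Definition vquot : Type := {ideal_quot pred_of_vspace T}.
HB.instance Definition _ := GRing.Zmodule.on vquot.

Definition vquot_pi (x : E) : vquot := \pi_({ideal_quot pred_of_vspace T})%qT x.
Definition vquot_repr (x : vquot) : E :=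
  repr (x : {ideal_quot pred_of_vspace T}).

Lemma vquot_reprK : cancel vquot_repr vquot_pi.
Proof. by move=> x; apply: (reprK (x : {ideal_quot pred_of_vspace T})). Qed.

Lemma vquot_pi_eq x y : (vquot_pi x == vquot_pi y) = (x - y \in T).
Proof. by rewrite (Quotient.idealrBE (pred_of_vspace T)). Qed.

Lemma vquot_piD x y : vquot_pi (x + y) = vquot_pi x + vquot_pi y.
Proof. exact: (raddfD (\pi_({ideal_quot pred_of_vspace T})%qT)). Qed.

Lemma vquot_reprB x : vquot_repr (vquot_pi x) - x \in T.
Proof. by rewrite -vquot_pi_eq vquot_reprK. Qed.

Definition vquot_scale (a : K) (x : vquot) : vquot :=
  vquot_pi (a *: vquot_repr x).

Lemma vquot_piZ a x : vquot_pi (a *: x) = vquot_scale a (vquot_pi x).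
Proof.
by apply/eqP; rewrite eq_sym vquot_pi_eq -scalerBr rpredZ ?vquot_reprB.
Qed.

Fact vquot_scaleA a b x :
  vquot_scale a (vquot_scale b x) = vquot_scale (a * b) x.
Proof. by rewrite -[x]vquot_reprK -!vquot_piZ scalerA. Qed.

Fact vquot_scale1 : left_id 1 vquot_scale.
Proof. by move=> x; rewrite -[x]vquot_reprK -!vquot_piZ scale1r. Qed.

Fact vquot_scaleDr : right_distributive vquot_scale +%R.
Proof.
move=> a x y; rewrite -[x]vquot_reprK -[y]vquot_reprK.
by rewrite -!(vquot_piZ, vquot_piD) scalerDr.
Qed.

Fact vquot_scaleDl x : {morph vquot_scale^~ x : a b / a + b}.
Proof.
move=> a b; rewrite -[x]vquot_reprK.
by rewrite -!(vquot_piZ, vquot_piD) scalerDl.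
Qed.

HB.instance Definition _ := GRing.Zmodule_isLmodule.Build K vquot
  vquot_scaleA vquot_scale1 vquot_scaleDr vquot_scaleDl.

Fact vquot_pi_is_linear : linear vquot_pi.
Proof. by move=> a x y; rewrite vquot_piD vquot_piZ. Qed.
HB.instance Definition _ :=
  GRing.isLinear.Build K E vquot _ vquot_pi vquot_pi_is_linear.

Let compl_proj (x : E) : subvs_of T^C := vsproj T^C (daddv_pi T^C T x).

Let compl_proj_pi x : vquot_pi (vsval (compl_proj x)) = vquot_pi x.
Proof.
have capT : (T^C :&: T = 0)%VS by rewrite capvC capv_compl.
have Dx : daddv_pi T^C T x + daddv_pi T T^C x = x.
  by rewrite daddv_pi_add // addvC addv_complf memvf.
apply/esym/eqP; rewrite vquot_pi_eq vsprojK ?memv_pi //.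
set y := daddv_pi T^C T x in Dx *; rewrite -Dx addrC addKr.
exact: memv_pi.
Qed.

Let vsvalK_pi w : compl_proj (vquot_repr (vquot_pi (vsval w))) = w.
Proof.
apply/val_inj; apply/eqP; rewrite -subr_eq0 -memv0 -(capv_compl T) memv_cap.
rewrite [X in _ && X]rpredB ?subvsP // andbT.
by rewrite -vquot_pi_eq compl_proj_pi vquot_reprK.
Qed.

Import VectorInternalTheory.
Fact vquot_vect_iso : Vector.axiom (dim (subvs_of T^C)) vquot.
Proof.
exists (fun x => VectorInternalTheory.v2r (compl_proj (vquot_repr x))).
  move=> a x y; rewrite -linearP; congr (v2r _).
  rewrite -[RHS]vsvalK_pi; congr (compl_proj (vquot_repr _)).
  by rewrite !linearP /= !compl_proj_pi !vquot_reprK.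
exists (fun u => vquot_pi (vsval (r2v u))).
  by move=> x; rewrite v2rK compl_proj_pi vquot_reprK.
by move=> u; rewrite vsvalK_pi r2vK.
Qed.
HB.instance Definition _ := Lmodule_hasFinDim.Build K vquot vquot_vect_iso.

Definition vproj : 'Hom(E, vquot) := linfun vquot_pi.

Lemma lker_vproj : lker vproj = T.
Proof.
apply/vspaceP=> x; rewrite memv_ker lfunE /= -(linear0 vquot_pi).
by rewrite vquot_pi_eq subr0.
Qed.

Lemma limg_vproj : limg vproj = fullv.
Proof.
apply/vspaceP=> x; rewrite memvf -[x]vquot_reprK -[vquot_pi _]lfunE.
exact: memv_img (memvf _).
Qed.

Lemma vproj_preimK (B : {vspace vquot}) : (vproj @: (vproj @^-1: B))%VS = B.
Proof. by rewrite lpreimK // limg_vproj subvf. Qed.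

Lemma sub_vproj_preim (B : {vspace vquot}) : (T <= vproj @^-1: B)%VS.
Proof. by rewrite -[X in (X <= _)%VS]lker_vproj -lpreim0 lpreimS ?sub0v. Qed.

Lemma vproj_imgK (A : {vspace E}) :
  (T <= A)%VS -> (vproj @^-1: (vproj @: A))%VS = A.
Proof.
move=> sTA; apply/vspaceP=> x; rewrite -memv_preim.
apply/idP/idP => [/memv_imgP[y Ay] | Ax]; last exact: memv_img.
rewrite !lfunE /= => /eqP; rewrite vquot_pi_eq => /(subvP sTA) Axy.
by rewrite -[x](subrK y) rpredD.
Qed.

Lemma dim_vproj_preim (B : {vspace vquot}) :
  \dim (vproj @^-1: B) = (\dim B + \dim T)%N.
Proof.
rewrite -(limg_ker_dim vproj) vproj_preimK lker_vproj.
by rewrite (capv_idPr (sub_vproj_preim B)) addnC.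
Qed.

End QuotientSpace.

(* (q,r)-polymatroids, where q = #|F|.                                        *)
Record polymatroid (F : finFieldType) (r : nat) (E : vectType F) := Polymatroid {
  rk :> {vspace E} -> nat;
  rk_bound : forall A : {vspace E}, (rk A <= r * \dim A)%N;
  rk_mono : forall A B : {vspace E}, (A <= B)%VS -> (rk A <= rk B)%N;
  rk_submod : forall A B : {vspace E},
    (rk (A + B)%VS + rk (A :&: B)%VS <= rk A + rk B)%N
}.

(* An involutory lattice anti-isomorphism of the lattice of subspaces; the    *)
(* complementary dimension is a consequence (dim_perp).                       *)
Record perp_op (K : fieldType) (E : vectType K) := PerpOp {
  perp :> {vspace E} -> {vspace E};
  perpS : forall A B : {vspace E}, (A <= B)%VS -> (perp B <= perp A)%VS;
  perpD : forall A B : {vspace E}, perp (A + B)%VS = (perp A :&: perp B)%VS;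
  perpI : forall A B : {vspace E}, perp (A :&: B)%VS = (perp A + perp B)%VS;
  perpK : involutive perp
}.

Section PerpTheory.
Variables (K : fieldType) (E : vectType K) (P : perp_op E).

Lemma perpT : P fullv = 0%VS.
Proof. by apply/eqP; rewrite -subv0 -[X in (_ <= X)%VS](perpK P) perpS ?subvf. Qed.

Lemma dim_perp_ge (A : {vspace E}) : (\dim {:E} - \dim A <= \dim (P A))%N.
Proof.
move Dk: (\dim {:E} - \dim A)%N => k.
elim: k A Dk => // k IHk A Dk.
have ltA : (\dim A < \dim {:E})%N by rewrite -subn_gt0 Dk.
have nz : (A^C)%VS != 0%VS by rewrite -dimv_eq0 dimv_compl Dk.
set v := vpick A^C; have v_A : v \notin A.
  apply: contra nz => Av; rewrite -vpick0 -memv0 -(capv_compl A).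
  by rewrite memv_cap Av memv_pick.
have nz_v : v != 0 by rewrite vpick0.
pose B := (A + <[v]>)%VS.
have dimB : \dim B = (\dim A).+1.
  rewrite dimv_disjoint_sum ?dim_vline ?nz_v ?addn1 //.
  apply/eqP; rewrite -subv0; apply/subvP=> w; rewrite memv_cap memv0.
  case/andP=> Aw /vlineP[a Dw]; move: Aw; rewrite Dw.
  case: (eqVneq a 0) => [-> | nza]; rewrite ?scale0r // => Aav.
  by case/negP: v_A; rewrite -[v](scalerK nza) rpredZ.
have := IHk B; rewrite dimB subnS Dk => /(_ erefl) leB.
apply: leq_ltn_trans leB _; rewrite ltn_neqAle dimvS ?perpS ?addvSl // andbT.
apply/negP=> /eqP eqd; have /eqP eqBA : P B == P A.
  by rewrite eqEdim perpS ?addvSl //= eqd.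
by have /esym/eqP := congr1 (fun X => \dim (P X)) eqBA; rewrite !perpK dimB ltn_eqF.
Qed.

Lemma dim_perp (A : {vspace E}) : \dim (P A) = (\dim {:E} - \dim A)%N.
Proof.
apply/eqP; rewrite eqn_leq dim_perp_ge andbT.
have := dim_perp_ge A^C%VS; rewrite dimv_compl subKn ?(dimvS (subvf _)) // => le1.
have: (\dim (P A + P A^C)%VS <= \dim {:E})%N := dimvS (subvf _).
rewrite dimv_disjoint_sum -?perpD ?addv_complf ?perpT // => le2.
rewrite -(leq_add2r (\dim A)) subnK ?(dimvS (subvf _)) //.
exact: leq_trans (leq_add (leqnn _) le1) le2.
Qed.

End PerpTheory.

Section Constructions.
Variables (F : finFieldType) (r : nat) (E : vectType F).
Implicit Types (M : polymatroid r E) (P : perp_op E) (A B T X : {vspace E}).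

Lemma rk_le_add M A B :
  (A <= B)%VS -> (M B <= M A + r * (\dim B - \dim A))%N.
Proof.
move=> sAB; have := rk_submod M A (B :\: A)%VS.
have -> : (A + (B :\: A))%VS = B.
  by rewrite addvC addv_diff (addv_idPl sAB).
move/(leq_trans (leq_addr _ _))/leq_trans; apply; rewrite leq_add2l.
apply: leq_trans (rk_bound M _) _; rewrite leq_mul2l; apply/orP; right.
by rewrite -(dimv_cap_compl B A) (capv_idPr sAB) addKn.
Qed.

(* The subtraction is never truncated: see dual_rank_ge.                      *)
Definition dual_rank M P A : nat := (r * \dim A + M (P A) - M fullv)%N.

Lemma dual_rank_ge M P A : (M fullv <= r * \dim A + M (P A))%N.
Proof.
rewrite addnC (leq_trans (rk_le_add M (subvf (P A)))) // leq_add2l.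
by rewrite dim_perp subKn // dimvS ?subvf.
Qed.

Fact dual_bound M P A : (dual_rank M P A <= r * \dim A)%N.
Proof. by rewrite leq_subLR addnC leq_add2r rk_mono ?subvf. Qed.

Fact dual_mono M P A B :
  (A <= B)%VS -> (dual_rank M P A <= dual_rank M P B)%N.
Proof.
move=> sAB; rewrite leq_sub2r //.
apply: leq_trans (leq_add (leqnn _) (rk_le_add M (perpS P sAB))) _.
have dA := dimvS (subvf A); have dB := dimvS (subvf B); have dAB := dimvS sAB.
have -> : (\dim (P A) - \dim (P B) = \dim B - \dim A)%N.
  by rewrite !dim_perp; lia.
by rewrite addnCA -mulnDr subnKC // addnC.
Qed.

Fact dual_submod M P A B :
  (dual_rank M P (A + B) + dual_rank M P (A :&: B) <=
     dual_rank M P A + dual_rank M P B)%N.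
Proof.
have := rk_submod M (P A) (P B); rewrite /dual_rank !perpD !perpI.
have := dual_rank_ge M P A; have := dual_rank_ge M P B.
have := dual_rank_ge M P (A + B)%VS; have := dual_rank_ge M P (A :&: B)%VS.
rewrite !perpD !perpI.
have : (r * \dim (A + B)%VS + r * \dim (A :&: B)%VS = r * \dim A + r * \dim B)%N.
  by rewrite -!mulnDr dimv_sum_cap.
lia.
Qed.

Definition dual M P : polymatroid r E :=
  Polymatroid (dual_bound M P) (@dual_mono M P) (dual_submod M P).

(* A subspace B of E/T is A/T for A the preimage of B under E -> E/T.         *)
Definition contract_rank M T (B : {vspace vquot T}) : nat :=
  (M (vproj T @^-1: B)%VS - M T)%N.

Fact contract_bound M T (B : {vspace vquot T}) : (contract_rank M B <= r * \dim B)%N.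
Proof.
rewrite leq_subLR (leq_trans (rk_le_add M (sub_vproj_preim B))) //.
by rewrite dim_vproj_preim addnK.
Qed.

Fact contract_mono M T (A B : {vspace vquot T}) :
  (A <= B)%VS -> (contract_rank M A <= contract_rank M B)%N.
Proof. by move=> sAB; rewrite leq_sub2r // rk_mono // lpreimS. Qed.

Fact contract_submod M T (A B : {vspace vquot T}) :
  (contract_rank M (A + B) + contract_rank M (A :&: B) <=
     contract_rank M A + contract_rank M B)%N.
Proof.
have subT C := rk_mono M (@sub_vproj_preim _ _ T C).
have capE : (vproj T @^-1: (A :&: B) = (vproj T @^-1: A) :&: (vproj T @^-1: B))%VS.
  by apply/vspaceP=> x; rewrite memv_cap -!memv_preim memv_cap.
have addE : (vproj T @^-1: (A + B) = (vproj T @^-1: A) + (vproj T @^-1: B))%VS.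
  rewrite -[RHS](@vproj_imgK _ _ T).
    by rewrite [(vproj T @: (_ + _))%VS]limgD !vproj_preimK.
  exact: subv_trans (sub_vproj_preim A) (addvSl _ _).
have := rk_submod M (vproj T @^-1: A)%VS (vproj T @^-1: B)%VS.
rewrite /contract_rank -capE -addE.
have := subT A; have := subT B; have := subT (A + B)%VS; have := subT (A :&: B)%VS.
lia.
Qed.

Definition contract M T : polymatroid r (vquot T) :=
  Polymatroid (contract_bound M (T := T)) (@contract_mono M T)
    (@contract_submod M T).

Lemma contractE M T A :
  (T <= A)%VS -> contract M T (vproj T @: A)%VS = (M A - M T)%N.
Proof. by move=> sTA; rewrite /= /contract_rank vproj_imgK. Qed.

Definition contract_to P M X : polymatroid r (vquot (P X)) := contract M (P X).

End Constructions.

(* The Moebius function of the lattice of subspaces, by its defining          *)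
(* recursion (mobius_id, mobius_sum); the fuel is immaterial once it is at    *)
(* least \dim V.                                                              *)
Section Mobius.
Variables (F : finFieldType) (E : vectType F).
Implicit Types U V W : {vspace E}.

Fixpoint mobius_rec (m : nat) U V : int :=
  if U == V then 1 else
  if m is m'.+1 then
    - \sum_(W : {vspace E} | [&& (U <= W)%VS, (W <= V)%VS & W != V])
        mobius_rec m' U W
  else 0.

Definition mobius U V : int := mobius_rec (\dim V) U V.

Lemma mobius_id U : mobius U U = 1.
Proof. by rewrite /mobius; case: (\dim U) => [|m] /=; rewrite eqxx. Qed.

Lemma mobius_rec_fuel m U V :
  (\dim V <= m)%N -> mobius_rec m U V = mobius U V.
Proof.
have ltd W V' : (W <= V')%VS -> W != V' -> (\dim W < \dim V')%N.
  move=> sWV neWV; rewrite ltn_neqAle dimvS // andbT.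
  by apply: contra neWV => /eqP eqd; rewrite eqEdim sWV eqd /=.
rewrite /mobius; have [k] := ubnP (\dim V); elim: k m V => // k IHk m V ltVk leVm.
case: m leVm => [|m] leVm; first by move: leVm; rewrite leqn0 => /eqP->.
case DV: (\dim V) => [|d] /=; case: eqP => // neUV.
  rewrite big1 ?oppr0 // => W /and3P[_ sWV neWV].
  by have := ltd _ _ sWV neWV; rewrite DV.
congr (- _); apply: eq_bigr => W /and3P[_ sWV neWV].
have ltWV := ltd _ _ sWV neWV; rewrite DV in ltWV ltVk leVm.
by rewrite (IHk m) ?(IHk d) //; lia.
Qed.

Lemma mobius_sum U V : (U <= V)%VS -> U != V ->
  \sum_(W : {vspace E} | (U <= W <= V)%VS) mobius U W = 0.
Proof.
move=> sUV neUV; rewrite (bigD1 V) ?sUV ?subvv //=.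
have -> : mobius U V = mobius_rec (\dim V).+1 U V by rewrite mobius_rec_fuel.
rewrite /= (negPf neUV) addrC; apply/eqP; rewrite subr_eq0; apply/eqP.
apply: eq_big => [W | W /andP[/andP[_ sWV] _]]; first by rewrite andbA.
by rewrite mobius_rec_fuel // dimvS.
Qed.

Lemma mobius_out U V : ~~ (U <= V)%VS -> mobius U V = 0.
Proof.
move=> nUV; rewrite /mobius; have neUV : U == V = false.
  by apply: contraNF nUV => /eqP->.
case: (\dim V) => [|m] /=; rewrite neUV // big1 ?oppr0 // => W /and3P[sUW sWV _].
by rewrite (subv_trans sUW sWV) in nUV.
Qed.

End Mobius.

Section CharacteristicPolynomial.
Variables (F : finFieldType) (r : nat) (E : vectType F) (N : polymatroid r E).

Definition corank (A : {vspace E}) : nat := (N fullv - N A)%N.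

Definition characteristic_poly : {poly int} :=
  \sum_(X : {vspace E}) mobius 0%VS X *: 'X^(corank X).

End CharacteristicPolynomial.

(* The product of the quotients (q^a - q^i) / (q^b - q^i), as a single        *)
(* division, which is exact by gaussianK.                                     *)
Definition gaussian (q a b : nat) : nat :=
  ((\prod_(i < b) (q ^ a - q ^ i)) %/ (\prod_(i < b) (q ^ b - q ^ i)))%N.

Section Gaussian.
Local Open Scope nat_scope.

Let gprod q a b := \prod_(i < b) (q ^ a - q ^ i).

Let gprodS q a b : gprod q a.+1 b.+1 = (q ^ a.+1 - 1) * (q ^ b * gprod q a b).
Proof.
rewrite /gprod big_ord_recl expn0; congr (_ * _).
rewrite -[in q ^ b](card_ord b) -prod_nat_const -big_split.
by apply: eq_bigr => i _; rewrite /= !expnS mulnBr.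
Qed.

Let gprod0 q a b : a < b -> gprod q a b = 0.
Proof.
by move=> ltab; rewrite /gprod (bigD1 (Ordinal ltab)) //= subnn mul0n.
Qed.

Let gprod_dvd q a b : 0 < q -> gprod q b b %| gprod q a b.
Proof.
move=> q_gt0; elim: a b => [|a IHa] [|b]; rewrite ?[gprod _ _ 0]big_ord0 //.
  by rewrite [gprod q 0 _]gprod0.
have [leba | ltab] := leqP b a; last by rewrite [gprod q a.+1 _]gprod0.
have -> : gprod q a.+1 b.+1
    = q ^ b.+1 * gprod q a b.+1 + (q ^ b.+1 - 1) * (q ^ b * gprod q a b).
  have -> : gprod q a b.+1 = gprod q a b * (q ^ a - q ^ b).
    by rewrite /gprod big_ord_recr.
  have -> : q ^ b.+1 * (gprod q a b * (q ^ a - q ^ b))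
      = q * (q ^ a - q ^ b) * (q ^ b * gprod q a b) by rewrite expnS; ring.
  rewrite gprodS -mulnDl mulnBr -!expnS.
  by rewrite addnBA ?expn_gt0 ?q_gt0 // subnK // leq_pexp2l.
apply: dvdn_add; first exact: dvdn_mull.
by rewrite gprodS dvdn_mul // dvdn_mul.
Qed.

Lemma gaussianK q a b : 0 < q ->
  gaussian q a b * \prod_(i < b) (q ^ b - q ^ i) = \prod_(i < b) (q ^ a - q ^ i).
Proof. by move=> q_gt0; apply/divnK/gprod_dvd. Qed.

End Gaussian.

(* Main.v *)
Require Import Defs.
From mathcomp Require Import all_boot all_order all_algebra all_field.
From mathcomp Require Import ring zify.
Import GRing.Theory.
Local Open Scope ring_scope.
Set Implicit Arguments.
Unset Strict Implicit.
Unset Printing Implicit Defensive.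

(** Write m(k) = (-1)^k q^(k choose 2), rho for the rank function of M and rho*
for that of its dual. The value mu(A, B) of the Moebius function is
m(dim B - dim A), and the identity is Moebius inversion over the lattice of
subspaces, applied to the two characteristic polynomials.

Pulling subspaces of E/T back to E gives
  p(M/T; z) = sum over A >= T of m(dim A - dim T) z^(rho(E) - rho(A))
([characteristic_poly_contract]). Inverting this relation in T = V^perp yields
  z^(rho(E) - rho(W)) = sum over the V with W <= V^perp of p(M.V; z)
([sum_characteristic_poly]). On the dual side, substituting A = W^perp and
using rho*(E) - rho*(W^perp) = r dim W - rho(W) turns the left-hand side into
  sum over W <= U of m(dim U - dim W) z^(r dim W) z^(rho(E) - rho(W))
([dual_characteristic_poly]). Replace the last factor by its expansion in the
p(M.V; z) and exchange the sums: p(M.V; z) gets as coefficient the sum of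
m(dim U - dim W) z^(r dim W) over W <= U meet V^perp. The summand depends on
dim W only, so grouping by dimension makes the Gaussian coefficients appear
([sum_subspaces_dim]).

Two facts about subspaces carry this. The Gaussian coefficient counts
subspaces ([card_subspaces]), by counting the free tuples that span them. And
the values m satisfy the two Moebius orthogonality relations on intervals: the
one from the bottom is the q-binomial identity [sum_gaussian_mobius] read in a
quotient space, the one from the top ([sum_interval_top]) is its image under
the anti-isomorphism perp. *)

(** * Counting subspaces by dimension *)

Section CountSubspaces.
Variables (F : finFieldType) (E : vectType F).
(* The type E itself carries no enumeration of its vectors; fE is E with one. *)
Local Notation fE := (finvect_type E).
Implicit Types (D X : {vspace E}).

Lemma card_mem_vspace D : #|[pred v : fE | v \in D]| = (#|F| ^ \dim D)%N.
Proof.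
(* E and fE carry the same structure only up to eta for records. *)
case: E D => T c D.
exact: (@card_vspace F (finvect_type (Vector.Pack c)) c D).
Qed.

Definition free_in D j : pred (j.-tuple fE) :=
  fun s => free (s : seq E) && (<<(s : seq E)>> <= D)%VS.

(** Given a free s of length j in D, exactly the q^(dim D) - q^j vectors of D
outside the span of s extend it to a free tuple of length j + 1. *)
Lemma card_free_in D j :
  #|@free_in D j| = (\prod_(i < j) (#|F| ^ \dim D - #|F| ^ i))%N.
Proof.
elim: j => [|j IHj].
  rewrite big_ord0 (eq_card (_ : _ =i predT)) ?card_tuple //.
  by move=> s; rewrite tuple0 unfold_in /free_in /= span_nil sub0v nil_free.
rewrite big_ord_recr -IHj /= -[LHS]sum1_card -[X in (X * _)%N]sum1_card big_distrl /=.
pose h (p : j.-tuple fE * fE) : j.+1.-tuple fE := [tuple of p.2 :: p.1].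
have hK : bijective h.
  exists (fun t : j.+1.-tuple fE => ([tuple of behead t], thead t)).
    by case=> s v; congr (_, _); apply/val_inj.
  by case/tupleP=> v s; apply/val_inj.
rewrite (reindex h) /=; last exact: onW_bij.
pose Q (s : j.-tuple fE) (v : fE) := (v \in D) && (v \notin <<(s : seq E)>>%VS).
rewrite (eq_bigl (fun p => (p.1 \in @free_in D j) && Q p.1 p.2)); last first.
  case=> s v; rewrite !unfold_in /free_in /Q /= free_cons span_cons subv_add.
  by rewrite -memvE; do !case: (_ \in _); do !case: free; do ?case: (_ <= _)%VS.
rewrite -(pair_big_dep (mem (@free_in D j)) Q (fun _ _ => 1%N)) /=.
apply: eq_bigr => s /andP[free_s sub_s]; rewrite sum1_card mul1n.
rewrite -card_mem_vspace.
have -> : (#|F| ^ j)%N = #|[pred v : fE | v \in <<(s : seq E)>>%VS]|.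
  by rewrite card_mem_vspace (eqnP free_s) size_tuple.
rewrite -[X in (X - _)%N](cardID [pred v : fE | v \in <<(s : seq E)>>%VS]).
rewrite [X in (X + _ - _)%N](eq_card (B := [pred v : fE | v \in <<(s : seq E)>>%VS])).
  by rewrite addKn; apply: eq_card => v; rewrite !inE andbC.
by move=> v; rewrite !inE andb_idl // => /(subvP sub_s).
Qed.

(** Sort the free j-tuples of D by the subspace that they span: each subspace of
dimension j arises from the same number of tuples, its ordered bases. *)
Lemma card_subspaces D j :
  #|[set X : {vspace E} | (X <= D)%VS && (\dim X == j)]| =
    gaussian #|F| (\dim D) j.
Proof.
have q_gt1 : (1 < #|F|)%N by exact: finNzRing_gt1.
apply/eqP; rewrite -(@eqn_pmul2r (\prod_(i < j) (#|F| ^ j - #|F| ^ i))); last first.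
  by apply: prodn_gt0 => i; rewrite subn_gt0 ltn_exp2l.
rewrite gaussianK 1?ltnW // -card_free_in; apply/eqP; rewrite -[RHS]sum1_card.
rewrite (partition_big (fun s : j.-tuple fE => <<(s : seq E)>>%VS)
  [in [set X : {vspace E} | (X <= D)%VS && (\dim X == j)]]) /=; last first.
  by move=> s /andP[/eqnP free_s sub_s]; rewrite inE sub_s free_s size_tuple /=.
rewrite -sum_nat_const; apply: eq_bigr => X; rewrite inE => /andP[sXD /eqP dX].
transitivity #|@free_in X j|; first by rewrite card_free_in dX.
rewrite -[LHS]sum1_card; apply: eq_bigl => s.
rewrite !unfold_in /free_in; case: (boolP (free _)) => //= free_s.
rewrite eqEdim (eqnP free_s) size_tuple dX leqnn andbT.
by rewrite andb_idl // => /subv_trans; apply.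
Qed.

End CountSubspaces.

(** * Moebius values and Gaussian coefficients *)

(** The value of the Moebius function of the subspace lattice on an interval of
length k; see [mobius0E]. *)
Definition mobius_coef (q k : nat) : int := (-1) ^+ k * (q ^ 'C(k, 2))%:R.

Lemma mobius_coefS q k :
  mobius_coef q k.+1 = - (q ^ k)%:R * mobius_coef q k.
Proof.
by rewrite /mobius_coef exprS binS bin1 expnD natrM; ring.
Qed.

Lemma gaussian0 q a : gaussian q a 0 = 1%N.
Proof. by rewrite /gaussian !big_ord0. Qed.

Lemma gaussian_small q a b : (a < b)%N -> gaussian q a b = 0%N.
Proof.
by move=> ltab; rewrite /gaussian (bigD1 (Ordinal ltab)) //= subnn mul0n div0n.
Qed.

(** The q-Pascal rule, in the version whose power of q combines with
[mobius_coefS] to an exponent independent of b. *)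
Lemma gaussianS q a b : (1 < q)%N -> (b <= a)%N ->
  gaussian q a.+1 b.+1 = (gaussian q a b.+1 + q ^ (a - b) * gaussian q a b)%N.
Proof.
move=> q_gt1 leba; have q_gt0 := ltnW q_gt1.
pose G a b := (\prod_(i < b) (q ^ a - q ^ i))%N.
have GS c d : G c.+1 d.+1 = ((q ^ c.+1 - 1) * (q ^ d * G c d))%N.
  rewrite /G big_ord_recl expn0; congr (_ * _)%N.
  rewrite -[in (q ^ d)%N](card_ord d) -prod_nat_const -big_split.
  by apply: eq_bigr => i _; rewrite /= !expnS mulnBr.
apply/eqP; rewrite -(@eqn_pmul2r (G b.+1 b.+1)); last first.
  by apply: prodn_gt0 => i; rewrite subn_gt0 ltn_exp2l.
rewrite mulnDl !gaussianK // -!/(G _ _) GS.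
have -> : G a b.+1 = (G a b * (q ^ a - q ^ b))%N by rewrite /G big_ord_recr.
have -> : (q ^ (a - b) * gaussian q a b * G b.+1 b.+1
    = (q ^ b.+1 - 1) * (q ^ (a - b) * (q ^ b * G a b)))%N.
  by rewrite GS -[G a b]gaussianK // -/(G b b); ring.
have -> : (q ^ a.+1 = q ^ b.+1 * q ^ (a - b))%N by rewrite -expnD addSn subnKC.
have -> : (q ^ a = q ^ (a - b) * q ^ b)%N by rewrite -expnD subnK.
(* With x = q^b * G a b, what remains is (s e x - x) = (e x - x) + (s e x - e x). *)
set e := (q ^ (a - b))%N; set x := (q ^ b * G a b)%N.
have e_gt0 : (0 < e)%N by rewrite expn_gt0 q_gt0.
have s_gt0 : (0 < q ^ b.+1)%N by rewrite expn_gt0 q_gt0.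
set s := (q ^ b.+1)%N in s_gt0 *.
rewrite !mulnBr !mulnBl !mul1n -!mulnA.
have -> : (G a b * (e * q ^ b) = e * x)%N by rewrite /x; ring.
have -> : (G a b * q ^ b = x)%N by rewrite /x mulnC.
have le1 : (x <= e * x)%N by rewrite leq_pmull.
have le2 : (e * x <= s * (e * x))%N by rewrite leq_pmull.
by apply/eqP; lia.
Qed.

(** The q-binomial theorem at -1: by the q-Pascal rule the sum for d + 1 is
1 - q^d times the sum for d, and this factor vanishes for d = 0. *)
Lemma sum_gaussian_mobius q d : (1 < q)%N ->
  \sum_(k < d.+1) mobius_coef q k *+ gaussian q d k = (d == 0%N)%:R.
Proof.
move=> q_gt1; case: d => [|d].
  by rewrite big_ord1 gaussian0.
have step n : \sum_(k < n.+2) mobius_coef q k *+ gaussian q n.+1 k =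
    (1 - (q ^ n)%:R) * \sum_(k < n.+1) mobius_coef q k *+ gaussian q n k.
  rewrite mulrBl mul1r mulr_sumr.
  have -> : \sum_(k < n.+1) mobius_coef q k *+ gaussian q n k =
      \sum_(k < n.+2) mobius_coef q k *+ gaussian q n k.
    by rewrite [RHS]big_ord_recr /= (gaussian_small q (ltnSn n)) mulr0n addr0.
  rewrite big_ord_recl [X in _ = X - _]big_ord_recl /= !gaussian0 -addrA.
  congr (_ + _); rewrite -sumrB; apply: eq_bigr => k _.
  have -> : bump 0 k = k.+1 by [].
  have lekn : (k <= n)%N by rewrite -ltnS.
  rewrite gaussianS // mulrnDr; congr (_ + _).
  have -> : (q ^ n = q ^ (n - k) * q ^ k)%N by rewrite -expnD subnK.
  rewrite -!(mulr_natr (mobius_coef _ _)) mobius_coefS !natrM.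
  move: (mobius_coef q k) (gaussian q n k)%:R (q ^ k)%:R (q ^ (n - k))%:R.
  by move=> c g x y; ring.
elim: d => [|d IHd]; last by rewrite step IHd mulr0.
by rewrite step expn0 subrr mul0r.
Qed.

(** * Moebius inversion in the lattice of subspaces *)

Section SumSubspaces.
Variables (F : finFieldType) (E : vectType F).
Implicit Types (A B D X T W : {vspace E}).
Local Notation q := #|F|.
Local Notation m := (mobius_coef q).

Lemma cardF_gt1 : (1 < #|F|)%N. Proof. exact: finNzRing_gt1. Qed.

Lemma sum_subspaces_dim (V : nmodType) (f : nat -> V) D :
  \sum_(X : {vspace E} | (X <= D)%VS) f (\dim X) =
  \sum_(k < (\dim D).+1) f k *+ gaussian q (\dim D) k.
Proof.
rewrite (partition_big (fun X : {vspace E} => inord (\dim X) : 'I_(\dim D).+1)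
           predT) //=.
apply: eq_bigr => k _; rewrite -card_subspaces -sumr_const.
apply: eq_big => [X | X /andP[sXD /eqP <-]].
  rewrite inE; apply: andb_id2l => sXD.
  by rewrite -val_eqE /= inordK // ltnS dimvS.
by rewrite inordK // ltnS dimvS.
Qed.

Lemma sum_mobius_coef D :
  \sum_(X : {vspace E} | (X <= D)%VS) m (\dim X) = (\dim D == 0%N)%:R.
Proof. by rewrite sum_subspaces_dim sum_gaussian_mobius ?cardF_gt1. Qed.

(** Both sides satisfy the recursion that defines the Moebius function. *)
Lemma mobius0E D : mobius 0%VS D = m (\dim D).
Proof.
have [n] := ubnP (\dim D); elim: n D => // n IHn D leDn.
have [-> | nzD] := eqVneq D 0%VS.
  by rewrite mobius_id dimv0.
have sum_mu : \sum_(W : {vspace E} | (W <= D)%VS) mobius 0%VS W = 0.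
  rewrite -[RHS](mobius_sum (sub0v D)) 1?eq_sym //.
  by apply: eq_bigl => W; rewrite sub0v.
have sum_m : \sum_(W : {vspace E} | (W <= D)%VS) m (\dim W) = 0.
  by rewrite sum_mobius_coef dimv_eq0 (negPf nzD).
move: (etrans sum_mu (esym sum_m)).
rewrite (bigD1 D) ?subvv //= [RHS](bigD1 D) ?subvv //=.
rewrite [X in _ + X](eq_bigr (fun W => m (\dim W))) => [e|W].
  exact: addIr e.
case/andP=> sWD neWD; apply: IHn.
rewrite -ltnS (leq_trans _ leDn) // ltnS ltn_neqAle dimvS // andbT.
by apply: contra neWD => /eqP dW; rewrite eqEdim sWD dW /=.
Qed.

End SumSubspaces.

Section Intervals.
Variables (F : finFieldType) (E : vectType F).
Implicit Types (A B T W : {vspace E}) (P : perp_op E).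
Local Notation m := (mobius_coef #|F|).

Lemma dim_vproj_img T A : (T <= A)%VS ->
  \dim (vproj T @: A) = (\dim A - \dim T)%N.
Proof. by move=> sTA; rewrite -[in RHS](vproj_imgK sTA) dim_vproj_preim addnK. Qed.

(** The correspondence between the subspaces of E/T and those of E above T. *)
Lemma sum_vquot (V : nmodType) T (p : pred {vspace vquot T})
    (f : {vspace vquot T} -> V) :
  \sum_(Z | p Z) f Z =
  \sum_(A : {vspace E} | (T <= A)%VS && p (vproj T @: A)%VS) f (vproj T @: A)%VS.
Proof.
rewrite (reindex_onto (fun A : {vspace E} => vproj T @: A)%VS
                      (fun Z => vproj T @^-1: Z)%VS); last first.
  by move=> Z _; apply: vproj_preimK.
apply: eq_bigl => A; rewrite andbC; congr (_ && _).
by apply/eqP/idP => [<- | /vproj_imgK //]; apply: sub_vproj_preim.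
Qed.

(** Passing to E/T moves the bottom of the interval to 0, where the sum is the
one of [sum_mobius_coef]. *)
Lemma sum_interval_bot T B : (T <= B)%VS ->
  \sum_(A : {vspace E} | (T <= A <= B)%VS) m (\dim A - \dim T) = (T == B)%:R.
Proof.
move=> sTB.
have -> : (T == B) = (\dim (vproj T @: B) == 0%N).
  by rewrite dim_vproj_img // subn_eq0 eqEdim sTB.
have <- : \sum_(Z : {vspace vquot T} | (Z <= vproj T @: B)%VS) m (\dim Z)
    = (\dim (vproj T @: B) == 0%N)%:R.
  by rewrite sum_mobius_coef.
rewrite sum_vquot; apply: eq_big => [A | A /andP[sTA _]]; last first.
  by rewrite dim_vproj_img.
apply: andb_id2l => sTA; apply/idP/idP => [/limgS -> // |].
by move/(lpreimS (vproj T)); rewrite !vproj_imgK.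
Qed.


Lemma perp_sub_perp P A B : (P A <= P B)%VS = (B <= A)%VS.
Proof.
by apply/idP/idP => [/(perpS P) | /(perpS P) //]; rewrite !perpK.
Qed.

(** The image of [sum_interval_bot] under the anti-isomorphism, which exchanges
the ends of intervals. This is the relation that inverts sums over the
subspaces above a given one. *)
Lemma sum_interval_top P W B : (W <= B)%VS ->
  \sum_(A : {vspace E} | (W <= A <= B)%VS) m (\dim B - \dim A) = (W == B)%:R.
Proof.
move=> sWB; rewrite -(inj_eq (inv_inj (perpK P))) eq_sym.
rewrite -sum_interval_bot ?perpS // [RHS](reindex_inj (inv_inj (perpK P))) /=.
apply: eq_big => [A | A /andP[sWA sAB]].
  by rewrite !perp_sub_perp andbC.
rewrite !dim_perp; congr m.
by have := dimvS (subvf A); have := dimvS (subvf B); lia.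
Qed.

(** * Characteristic polynomials of contractions *)

Variable r : nat.
Implicit Type M : polymatroid r E.

Lemma characteristic_poly_contract M T :
  characteristic_poly (contract M T) =
  \sum_(A : {vspace E} | (T <= A)%VS)
     m (\dim A - \dim T) *: 'X^(M fullv - M A).
Proof.
rewrite /characteristic_poly sum_vquot.
apply: eq_big => [A | A /andP[sTA _]]; first by rewrite andbT.
rewrite mobius0E dim_vproj_img //; congr (_ *: 'X^_).
rewrite /corank contractE // /= /contract_rank.
have -> : (vproj T @^-1: fullv)%VS = fullv.
  by rewrite -(limg_vproj T) vproj_imgK ?subvf.
by have := rk_mono M sTA; have := rk_mono M (subvf A); lia.
Qed.

(** Moebius inversion of [characteristic_poly_contract]: by [sum_interval_top],
after exchanging sums only the term A = W survives. *)
Lemma sum_characteristic_poly P M W :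
  \sum_(V : {vspace E} | (W <= P V)%VS) characteristic_poly (contract_to P M V) =
  'X^(M fullv - M W).
Proof.
rewrite (reindex_inj (inv_inj (perpK P))) /=.
rewrite (eq_bigl (fun T => (W <= T)%VS)) => [|T]; last by rewrite perpK.
rewrite (eq_bigr (fun T => \sum_(A : {vspace E} | (T <= A)%VS)
     m (\dim A - \dim T) *: 'X^(M fullv - M A))) => [|T _]; last first.
  by rewrite /contract_to characteristic_poly_contract perpK.
rewrite (exchange_big_dep (fun A => (W <= A)%VS)) /=; last first.
  by move=> T A; apply: subv_trans.
rewrite (bigD1 W) ?subvv //= [X in _ + X]big1 => [|A /andP[sWA neAW]]; last first.
  by rewrite -scaler_suml (sum_interval_top P sWA) eq_sym (negPf neAW) scale0r.
by rewrite -scaler_suml (sum_interval_top P (subvv W)) eqxx scale1r addr0.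
Qed.

(** Substitute A = P W in [characteristic_poly_contract]: the corank of P W in the
dual is r dim W - M W, because M vanishes on the zero space. *)
Lemma dual_characteristic_poly P M (U : {vspace E}) :
  'X^(M fullv) * characteristic_poly (contract_to P (dual M P) U) =
  \sum_(W : {vspace E} | (W <= U)%VS)
     (m (\dim U - \dim W) *: 'X^(\dim W * r)) * 'X^(M fullv - M W).
Proof.
rewrite characteristic_poly_contract (reindex_inj (inv_inj (perpK P))) mulr_sumr.
apply: eq_big => [W | W]; rewrite perp_sub_perp // => sWU.
rewrite -scalerAl -scalerAr -!exprD; congr (_ *: 'X^_).
  rewrite !dim_perp; congr m.
  by have := dimvS (subvf W); have := dimvS (subvf U); lia.
rewrite /= /dual_rank perpT perpK dim_perp.
have M0 : M 0%VS = 0%N.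
  by apply/eqP; rewrite -leqn0; have := rk_bound M 0%VS; rewrite dimv0 muln0.
have dW := dimvS (subvf W).
have := dual_rank_ge M P (P W); have := dual_rank_ge M P fullv.
rewrite perpT perpK dim_perp M0 !addn0.
have := rk_mono M (subvf W); have := rk_bound M W.
by rewrite mulnBr [(\dim W * r)%N]mulnC; have := leq_mul (leqnn r) dW; lia.
Qed.

End Intervals.

Theorem corollary58 (q n r : nat) (F : finFieldType) (E : vectType F)
    (hq : #|F| = q) (hn : \dim {:E} = n) (n_gt0 : (0 < n)%N) (r_gt0 : (0 < r)%N)
    (P : perp_op E) (M : polymatroid r E) (U : {vspace E}) :
  'X^(M fullv) * characteristic_poly (contract_to P (dual M P) U) =
  \sum_(V : {vspace E})
     characteristic_poly (contract_to P M V) *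
     \sum_(0 <= j < (\dim (U :&: P V)).+1)
        ((gaussian q (\dim (U :&: P V)) j)%:R * (-1) ^+ (\dim U - j)
           * (q ^ 'C(\dim U - j, 2))%:R) *: 'X^(j * r).
Proof.
rewrite -{}hq dual_characteristic_poly.
pose c (W : {vspace E}) : {poly int} :=
  mobius_coef #|F| (\dim U - \dim W) *: 'X^(\dim W * r).
have inner (V : {vspace E}) :
    \sum_(0 <= j < (\dim (U :&: P V)).+1)
        ((gaussian #|F| (\dim (U :&: P V)) j)%:R * (-1) ^+ (\dim U - j)
           * (#|F| ^ 'C(\dim U - j, 2))%:R) *: 'X^(j * r)
    = \sum_(W : {vspace E} | (W <= U)%VS && (W <= P V)%VS) c W.
  rewrite (eq_bigl (fun W => (W <= U :&: P V)%VS)) => [|W]; last by rewrite subv_cap.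
  pose f k : {poly int} := mobius_coef #|F| (\dim U - k) *: 'X^(k * r).
  rewrite (sum_subspaces_dim f) big_mkord; apply: eq_bigr => j _.
  by rewrite /f scalerMnl -mulrA mulr_natl.
under [RHS]eq_bigr do rewrite inner mulrC mulr_suml.
rewrite (exchange_big_dep (fun W => (W <= U)%VS)) /=; last by move=> V W _ /andP[].
apply: eq_bigr => W sWU; rewrite -(sum_characteristic_poly P) mulr_sumr.
by apply: eq_bigl => V; rewrite sWU.
Qed.
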